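(* Let $P(q)$ be the Poincaré series of the Fuchsian singularity associated with a Fuchsian group of signature $(g;a_1,\dots,a_r)$, that is, $$P(q)=\frac{1+(g-2)q+(g-2)q^2+q^3}{(1-q)^2}+\sum_{i=1}^r\frac{q^2(1-q^{a_i-1})}{(1-q)^2(1-q^{a_i})}.$$ Then there exists a $2$-tangle whose $q$-fraction equals $(1+q)^2P(-q)/q^{3/2}$.
   Context: 2-tangles. A $2$-tangle is a (tame) embedding of two segments and finitely many (possibly zero) circles in a three-dimensional ball such that only the endpoints of the segments lie on the boundary sphere. The four endpoints are placed at the standard positions NW, NE, SW, SE of a planar diagram, and all components are oriented so that the strands enter the ball at NW and SE and leave it at NE and SW. The numerator closure of the tangle is the oriented link obtained by joining NW to NE and SW to SE by simple unknotted arcs outside the ball; the denominator closure is the oriented link obtained by joining NW to SW and NE to SE in the same way. Alexander polynomials. Put $z=q^{-1/2}-q^{1/2}$. The Alexander polynomial $\Delta_L(q)$ of an oriented link $L$ is normalized so that the substitution $q\to q^{-1}$ multiplies it by $\pm1$; concretely one uses Conway's normalization, $\Delta=1$ for the unknot and $\Delta_{L_+}-\Delta_{L_-}=z\,\Delta_{L_0}$ for a skein triple. $q$-fraction. The $q$-fraction of a $2$-tangle is the quotient of the Alexander polynomial of its numerator closure by the Alexander polynomial of its denominator closure (the latter being nonzero). Fuchsian singularities. These arise from the action of (cocompact) Fuchsian groups on the tangent bundle of the upper half-plane. The signature $(g;a_1,\dots,a_r)$ consists of the genus $g\ge0$ of the quotient and the orders $a_i\ge2$ of the branch points ($r\ge0$).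 The displayed formula for $P(q)$ is a known formula for the Poincaré series of the corresponding graded algebra and may be taken as its definition here. *)

(* Defs.v *)
From HB Require Import structures.
From mathcomp Require Import all_boot all_order all_algebra.
From mathcomp Require Import ring.
From Stdlib Require Import Relation_Operators.

Set Implicit Arguments.
Unset Strict Implicit.
Unset Printing Implicit Defensive.

Import GRing.Theory.
Local Open Scope ring_scope.

(* Tame oriented tangles are represented by their sliced (Morse) diagrams, cut
   by horizontal lines into slices each containing one crossing or one local
   extremum, and read from top to bottom.  Ambient isotopy is the equivalence
   generated by Turaev's moves on these diagrams. *)

(* Direction of a strand at a horizontal line. *)
Definition dir := bool.
Notation dn := (true : dir).
Notation up := (false : dir).

(* - [Max d]: a local maximum, starting two strands below it, the left one with
     direction [d] and the right one with direction [~~ d];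
   - [Min]: a local minimum, ending two adjacent strands;
   - [Cross b]: two adjacent strands cross; the over-strand is the one joining
     top right to bottom left if [b], top left to bottom right otherwise.  If
     both strands go down, or both go up, the crossing is positive iff [b]. *)
Inductive elem := Max of dir | Min | Cross of bool.

(* The elementary diagram [e] placed to the right of [i] vertical strands. *)
Definition slice : Type := (nat * elem)%type.

(* Directions of the strands below a slice from those above it; [None] if the
   slice does not fit. *)
Definition elem_step (e : elem) (s : seq dir) : option (seq dir) :=
  match e, s with
  | Max d, _ => Some [:: d, ~~ d & s]
  | Min, [:: x, y & s'] => if x == ~~ y then Some s' else None
  | Cross _, [:: x, y & s'] => Some [:: y, x & s']
  | _, _ => None
  end.

Fixpoint slice_step (i : nat) (e : elem) (s : seq dir) : option (seq dir) :=
  match i, s with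
  | 0, _ => elem_step e s
  | j.+1, x :: s' => omap (cons x) (slice_step j e s')
  | _.+1, [::] => None
  end.

Fixpoint run (w : seq slice) (s : seq dir) : option (seq dir) :=
  if w is (i, e) :: w' then obind (run w') (slice_step i e s) else Some s.

(* Oriented tangle diagrams with directions [s] at the top and [t] at the
   bottom. *)
Record diagram (s t : seq dir) := Diagram {
  slices :> seq slice;
  slicesP : run slices s == Some t
}.

Definition link := diagram [::] [::].

Definition arity_in (e : elem) : nat := if e is Max _ then 0 else 2.
Definition arity_out (e : elem) : nat := if e is Min then 0 else 2.

(* Turaev's moves. *)
Inductive move : seq slice -> seq slice -> Prop :=
  (* far commutation *)
| Mexch i k e f :
    move [:: (i, e); (i + arity_out e + k, f)]
         [:: (i + arity_in e + k, f); (i, e)]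
  (* straightening *)
| Mzigl i d : move [:: (i, Max d); (i.+1, Min)] [::]
| Mzigr i d : move [:: (i.+1, Max d); (i, Min)] [::]
  (* Reidemeister moves *)
| MR1r i d b : move [:: (i.+1, Max d); (i, Cross b); (i.+1, Min)] [::]
| MR1l i d b : move [:: (i, Max d); (i.+1, Cross b); (i, Min)] [::]
| MR2 i b : move [:: (i, Cross b); (i, Cross (~~ b))] [::]
| MR3 i b : move [:: (i, Cross b); (i.+1, Cross b); (i, Cross b)]
                 [:: (i.+1, Cross b); (i, Cross b); (i.+1, Cross b)]
  (* passing a strand over or under a local extremum *)
| Mmax i d b : move [:: (i, Max d); (i.+1, Cross b)]
                    [:: (i.+1, Max d); (i, Cross (~~ b))]
| Mmin i b : move [:: (i.+1, Cross b); (i, Min)]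
                  [:: (i, Cross (~~ b)); (i.+1, Min)].

(* Both sides being well-formed diagrams with the same ends, directions are
   respected by each move. *)
Definition moved s t (D D' : diagram s t) : Prop :=
  exists u l r v, [/\ move l r, slices D = u ++ l ++ v
                    & slices D' = u ++ r ++ v].

Definition isotopic s t : diagram s t -> diagram s t -> Prop :=
  clos_refl_sym_trans (diagram s t) (@moved s t).

(* The field of rational functions in q^(1/2), which contains the ring
   Z[q^(1/2), q^(-1/2)] of the values of the Alexander polynomial. *)
Definition ratfun := {fraction {poly int}}.

Definition qhalf : ratfun := tofrac 'X.
Definition q : ratfun := qhalf ^+ 2.
Definition z : ratfun := qhalf^-1 - qhalf.

Definition unknot : link := @Diagram [::] [::] [:: (0%N, Max dn); (0%N, Min)] isT.

(* Up to isotopy, a crossing can always be rotated so that both of its strands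
   go in the same vertical direction [d]; its oriented smoothing is then a pair
   of vertical strands. *)
Definition skein_triple (Lp Lm L0 : link) : Prop :=
  exists u s1 d s2 v,
    [/\ run u [::] = Some (s1 ++ [:: d, d & s2]),
        slices Lp = u ++ (size s1, Cross true) :: v,
        slices Lm = u ++ (size s1, Cross false) :: v
      & slices L0 = u ++ v].

(* The Alexander polynomial of oriented links, in Conway's normalization.  A
   function with these properties exists (lemma [alexander_exists] below), and
   it is well known to be unique on non-empty links. *)
Definition is_alexander (Delta : link -> ratfun) : Prop :=
  [/\ forall L L', isotopic L L' -> Delta L = Delta L',
      Delta unknot = 1
    & forall Lp Lm L0, skein_triple Lp Lm L0 ->
        Delta Lp - Delta Lm = z * Delta L0].

(* The upper ends are NW, NE and the lower ends are SW, SE: strands enter the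
   ball at NW and SE and leave it at NE and SW. *)
Definition tangle2 := diagram [:: dn; up] [:: dn; up].

Lemma run_cat w1 w2 s : run (w1 ++ w2) s = obind (run w2) (run w1 s).
Proof.
by elim: w1 s => [|[i e] w1 IH] s //=; case: (slice_step i e s) => //= ?.
Qed.

Lemma step_rcat i e s t s' :
  slice_step i e s = Some t -> slice_step i e (s ++ s') = Some (t ++ s').
Proof.
elim: i s t => [|i IH] s t.
  by case: e => [d||b]; case: s => [|x [|y s]] //=;
    do ?[case: ifP => // _]; case=> <-.
by case: s => [|x s] //=; case E: (slice_step i e s) => [s1|] //= [<-];
  rewrite (IH _ _ E).
Qed.

Lemma run_rcat w s t s' :
  run w s = Some t -> run w (s ++ s') = Some (t ++ s').
Proof.
elim: w s => [|[i e] w IH] s /= => [[->] //|].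
by case E: (slice_step i e s) => [s1|] //= /IH H; rewrite (step_rcat s' E).
Qed.

Definition shift (w : seq slice) : seq slice := [seq (l.1.+1, l.2) | l <- w].

Lemma run_shift w x s t :
  run w s = Some t -> run (shift w) (x :: s) = Some (x :: t).
Proof.
elim: w s => [|[i e] w IH] s /= => [[->] //|].
by case: (slice_step i e s) => [s1|] //= /IH.
Qed.

Definition num_slices (w : seq slice) : seq slice :=
  (0%N, Max dn) :: w ++ [:: (0%N, Min)].

Lemma num_slicesP (T : tangle2) : run (num_slices T) [::] == Some [::].
Proof. by rewrite /= run_cat (eqP (slicesP T)). Qed.

Definition numerator (T : tangle2) : link := Diagram (num_slicesP T).

(* One arc from SW to NW to the left of the tangle, one from NE to SE to its
   right. *)
Definition den_slices (w : seq slice) : seq slice :=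
  [:: (0%N, Max up); (2%N, Max up)] ++ shift w ++ [:: (0%N, Min); (0%N, Min)].

Lemma den_slicesP (T : tangle2) : run (den_slices T) [::] == Some [::].
Proof.
by rewrite /= run_cat
  (run_shift up (run_rcat [:: dn] (eqP (slicesP T)))).
Qed.

Definition denominator (T : tangle2) : link := Diagram (den_slicesP T).

Definition has_qfraction (T : tangle2) (f : ratfun) : Prop :=
  forall Delta, is_alexander Delta ->
    Delta (denominator T) != 0 /\
    Delta (numerator T) / Delta (denominator T) = f.

(* The series P as a rational function, evaluated at [x]; it is used below only
   at x = - q, where no denominator vanishes. *)
Definition poincare (g : nat) (a : seq nat) (x : ratfun) : ratfun :=
  (1 + (g%:R - 2) * x + (g%:R - 2) * x ^+ 2 + x ^+ 3) / (1 - x) ^+ 2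
  + \sum_(n <- a) x ^+ 2 * (1 - x ^+ n.-1) / ((1 - x) ^+ 2 * (1 - x ^+ n)).

(* Existence of a function satisfying [is_alexander]: the functor from tangle
   diagrams to representations of U_q(gl(1|1)) vanishes on closed diagrams, so
   one cuts open the first maximum of the diagram.  The result is independent
   of the chosen maximum ([cup_exchange]) because the functor commutes with the
   two odd generators ([act]). *)
Module GL11.

Section Model.
Context (F : fieldType) (t : F) (t0 : t != 0).
Let zz := t^-1 - t.

(* A direction, and the index of a basis vector of the defining module
   (direction [dn]) or of its dual (direction [up]). *)
Definition strand : Type := (dir * bool)%type.
Definition mu (n : bool) : F := if n then - t else t.

Definition alpha (d n : bool) : F := if d then 1 else (mu n)^-1.
Definition beta (d n : bool) : F := if d then mu n else 1.

(* The R-matrix ([b = true]) or its inverse, for two strands going down; [Rw]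
   gives the other directions by rotation. *)
Definition Rp (b a1 a2 c1 c2 : bool) : F :=
  match a1, a2, c1, c2 with
  | false, false, false, false => if b then t^-1 else t
  | true, true, true, true => if b then - t else - t^-1
  | false, true, true, false => 1
  | true, false, false, true => 1
  | true, false, true, false => if b then zz else 0
  | false, true, false, true => if b then 0 else - zz
  | _, _, _, _ => 0
  end.

Definition Rw (b d1 d2 a1 a2 c1 c2 : bool) : F :=
  match d1, d2 with
  | true, true => Rp b a1 a2 c1 c2
  | false, false => Rp b c2 c1 a2 a1
  | true, false => Rp (~~ b) c1 a1 c2 a2 * mu a2 / mu c1
  | false, true => Rp (~~ b) a2 c2 a1 c1
  end.

(* Covectors on the tensor product attached to a row of strands. *)
Definition wt := seq strand -> F.

Definition loc (e : elem) (f : wt) : wt := fun c =>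
  match e, c with
  | Max d, _ => alpha d false * f [:: (d, false), (~~ d, false) & c]
              + alpha d true * f [:: (d, true), (~~ d, true) & c]
  | Min, (x, m) :: (y, n) :: c' =>
      if (x == ~~ y) && (m == n) then beta x m * f c' else 0
  | Cross b, (x, m) :: (y, n) :: c' =>
      Rw b x y m n n m * f [:: (y, n), (x, m) & c']
    + Rw b x y m n (~~ n) (~~ m) * f [:: (y, ~~ n), (x, ~~ m) & c']
  | _, _ => 0
  end.

Fixpoint pull (i : nat) (e : elem) (f : wt) (c : seq strand) : F :=
  match i, c with
  | 0, _ => loc e f c
  | j.+1, x :: c' => pull j e (fun c'' => f (x :: c'')) c'
  | _.+1, [::] => 0
  end.

Fixpoint pulls (w : seq slice) (f : wt) : wt :=
  if w is (i, e) :: w' then pull i e (pulls w' f) else f.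

Definition dirs (c : seq strand) : seq dir := [seq x.1 | x <- c].

Lemma loc_ext e f g c s : elem_step e (dirs c) = Some s ->
  (forall c', dirs c' = s -> f c' = g c') -> loc e f c = loc e g c.
Proof.
case: e => [d||b]; case: c => [|[x m] [|[y n] c]] //=.
- by move=> [<-] H; rewrite !H.
- by move=> [<-] H; rewrite !H.
- by move=> [<-] H; rewrite !H.
- by case: (x == ~~ y) => //= [[<-]] H; rewrite H.
- by move=> [<-] H; rewrite !H.
Qed.

Lemma pull_ext i e f g c s : slice_step i e (dirs c) = Some s ->
  (forall c', dirs c' = s -> f c' = g c') -> pull i e f c = pull i e g c.
Proof.
elim: i f g c s => [|i IH] f g c s /=; first exact: loc_ext.
case: c => [|x c] //=.
case E: (slice_step i e (dirs c)) => [s1|] //= [<-] H.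
by apply: (IH _ _ _ s1 E) => c' H'; apply: H; rewrite /= H'.
Qed.

Lemma pulls_ext w f g c s : run w (dirs c) = Some s ->
  (forall c', dirs c' = s -> f c' = g c') -> pulls w f c = pulls w g c.
Proof.
elim: w c => [|[i e] w IH] c /=; first by move=> [<-]; apply.
case E: (slice_step i e (dirs c)) => [s1|] //= R H.
apply: (pull_ext E) => c' E'; apply: IH => //; by rewrite E'.
Qed.

Lemma loc_fext e f g c : (forall c', f c' = g c') -> loc e f c = loc e g c.
Proof.
by move=> H; case: e => [d||b]; case: c => [|[x m] [|[y n] c]] //=; rewrite !H.
Qed.

Lemma pull_fext i e f g c : (forall c', f c' = g c') -> pull i e f c = pull i e g c.
Proof.
elim: i f g c => [|i IH] f g c H; first exact: loc_fext.
by case: c => [|x c] //=; apply: IH.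
Qed.

Lemma loc_lin e a b f g c :
  loc e (fun c' => a * f c' + b * g c') c = a * loc e f c + b * loc e g c.
Proof.
by case: e => [d||b']; case: c => [|[x m] [|[y n] c]] //=;
  do ?case: ifP => _; ring.
Qed.

Lemma pull_lin i e a b f g c :
  pull i e (fun c' => a * f c' + b * g c') c = a * pull i e f c + b * pull i e g c.
Proof.
elim: i f g c => [|i IH] f g c; first exact: loc_lin.
by case: c => [|x c] /=; [ring | rewrite IH].
Qed.

Lemma pull0 i e c : pull i e (fun _ => 0) c = 0.
Proof.
rewrite (pull_fext _ _ _ (g := fun c => 0 * 0 + 0 * 0)); last by move=> ?; ring.
by rewrite (pull_lin i e 0 0 (fun=> 0) (fun=> 0)); ring.
Qed.

Lemma pullZ i e a f c : pull i e (fun c' => a * f c') c = a * pull i e f c.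
Proof.
rewrite -[RHS]addr0 -[X in _ + X](mul0r (pull i e f c)) -pull_lin.
by apply: pull_fext => ?; ring.
Qed.

Lemma pullD i e f g c : pull i e (fun c' => f c' + g c') c = pull i e f c + pull i e g c.
Proof.
rewrite -[X in X + _]mul1r -[X in _ + X]mul1r -pull_lin.
by apply: pull_fext => ?; ring.
Qed.

Lemma pulls_shift w f x c :
  pulls (shift w) f (x :: c) = pulls w (fun c' => f (x :: c')) c.
Proof.
by elim: w c => [|[i e] w IH] c //=; apply: pull_fext => c'; apply: IH.
Qed.

Lemma run_unshift w x s t' : run (shift w) (x :: s) = Some t' ->
  exists2 t1, run w s = Some t1 & t' = x :: t1.
Proof.
elim: w s => [|[i e] w IH] s /=; first by move=> [<-]; exists s.
by case: (slice_step i e s) => [s1|] //= /IH.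
Qed.

Definition good l r := forall f c s1 s2,
  run l (dirs c) = Some s1 -> run r (dirs c) = Some s2 -> pulls l f c = pulls r f c.

Lemma good_shift l r : l <> [::] -> good l r -> good (shift l) (shift r).
Proof.
move=> nl H f c s1 s2; case: c => [|x c].
  by case: l nl H => [|[i e] l].
move=> /run_unshift [u1 R1 _] /run_unshift [u2 R2 _].
by rewrite !pulls_shift; apply: H R1 R2.
Qed.

Lemma far i e k g f c : 
  pulls [:: (i, e); (i + arity_out e + k, g)]%N f c =
  pulls [:: (i + arity_in e + k, g); (i, e)]%N f c.
Proof.
elim: i f c => [|i IH] f [|x c] //=.
- by case: e => [d||b] //=; rewrite ?add0n /= ?pullD ?pullZ ?pull0.
- case: e => [d||b] //=; rewrite !add0n /= ?pullD ?pullZ //.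
  + case: x => x m; case: c => [|[y n] c] //=. 
    by case: ifP => _; rewrite ?pullZ ?pull0.
  + by case: x => x m; case: c => [|[y n] c] //=; rewrite !pullD !pullZ.
- exact: IH.
Qed.

Definition flip_coef (h d : bool) : F := if d then 1 else - (mu (~~ h))^-1.
Definition kk (d n : bool) : F := if d then mu n else (mu n)^-1.

(* The raising ([h = false]) or lowering ([h = true]) generator, acting through
   the coproduct. *)
Fixpoint act (h : bool) (f : wt) (c : seq strand) : F :=
  if c is (d, n) :: c' then
    (if n == h (+) ~~ d then flip_coef h d * f ((d, ~~ n) :: c') else 0)
    + kk d n * act h (fun c'' => f ((d, n) :: c'')) c'
  else 0.

Lemma act_fext h f g c : (forall c', f c' = g c') -> act h f c = act h g c.
Proof.
by elim: c f g => [|[d n] c IH] f g H //=; rewrite !H (IH _ (fun c'' => g ((d,n)::c''))).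
Qed.

Lemma act_lin h a b f g c :
  act h (fun c' => a * f c' + b * g c') c = a * act h f c + b * act h g c.
Proof.
elim: c f g => [|[d n] c IH] f g //=; first by ring.
by rewrite IH; case: ifP => _; ring.
Qed.
Lemma actZ h a f c : act h (fun c' => a * f c') c = a * act h f c.
Proof.
rewrite -[RHS]addr0 -[X in _ + X](mul0r (act h f c)) -act_lin.
by apply: act_fext => ?; ring.
Qed.
Lemma actD h f g c : act h (fun c' => f c' + g c') c = act h f c + act h g c.
Proof.
rewrite -[X in X + _]mul1r -[X in _ + X]mul1r -act_lin.
by apply: act_fext => ?; ring.
Qed.
Lemma act0 h c : act h (fun _ => 0) c = 0.
Proof. by rewrite (act_fext _ (g := fun c => 0 * 0)) ?actZ ?mul0r // => ?; ring. Qed.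

Lemma act_loc h e f c s : elem_step e (dirs c) = Some s ->
  act h (loc e f) c = loc e (act h f) c.
Proof.
have N0 : - t != 0 by rewrite oppr_eq0.
case: e => [d||b].
- move=> _; rewrite (act_fext _ (g := fun c =>
    alpha d false * f [:: (d, false), (~~ d, false) & c]
    + alpha d true * f [:: (d, true), (~~ d, true) & c])) //.
  rewrite /= actD !actZ /=.
  by case: d; case: h; rewrite /alpha /flip_coef /kk /mu /=; field; rewrite ?t0 ?N0.
- case: c => [|[x m] [|[y n] c]] //=; case: eqP => // -> _.
  case: y; case: n; case: m; case: h;
    rewrite /= ?actZ ?act0 /flip_coef /kk /mu /beta /=; field; rewrite ?t0 ?N0 //.
- case: c => [|[x m] [|[y n] c]] //= _.
  case: b; case: x; case: y; case: m; case: n; case: h;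
  rewrite /= !actD !actZ /flip_coef /kk /mu /Rw /Rp /mu /zz /=; field; rewrite ?t0 ?N0 //.
Qed.

Lemma act_pull h i e f c s : slice_step i e (dirs c) = Some s ->
  act h (pull i e f) c = pull i e (act h f) c.
Proof.
elim: i f c s => [|i IH] f c s; first exact: act_loc.
case: c => [|[d n] c] //=; case E: slice_step => [s1|] //= _.
rewrite (IH _ _ _ E) pullD pullZ; congr (_ + _).
by case: ifP => _; rewrite ?pullZ ?pull0.
Qed.

Definition base : wt := fun c => (nilp c)%:R.

Lemma act_pulls h w c : run w (dirs c) = Some [::] -> act h (pulls w base) c = 0.
Proof.
elim: w c => [|[i e] w IH] c /=; first by case: c.
case E: slice_step => [s|] //= R; rewrite (act_pull _ _ E).
rewrite (pull_ext (g := fun=> 0) E) ?pull0 // => c' E'.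
by apply: IH; rewrite E'.
Qed.

Lemma good_move l r : move l r -> l <> [::] /\ good l r.
Proof.
have S : forall (L R : nat -> seq slice), (forall i, L i.+1 = shift (L i)) ->
    (forall i, R i.+1 = shift (R i)) -> L 0%N <> [::] -> good (L 0%N) (R 0%N) ->
    forall i, L i <> [::] /\ good (L i) (R i).
  move=> L R HL HR L0 G; elim=> [|i [N G']] //; rewrite HL HR; split.
    by case: (L i) N.
  exact: good_shift.
have N0 : -t != 0 by rewrite oppr_eq0.
case=> {l r} [i k e f|i d|i d|i d b|i d b|i b|i b|i d b|i b].
- split=> // w c s1 s2 _ _; exact: far.
- apply: (S (fun i => [:: (i, Max d); (i.+1, Min)]) (fun _ => [::])) => // f c s1 s2.
  case: c => [|[x m] c] //=; case: d; case: x => //= _ _; case: m;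
  by rewrite /= /alpha /beta /mu; field; rewrite ?t0 ?N0.
- apply: (S (fun i => [:: (i.+1, Max d); (i, Min)]) (fun _ => [::])) => // f c s1 s2.
  case: c => [|[x m] c] //=; case: d; case: x => //= _ _; case: m;
  by rewrite /= /alpha /beta /mu; field; rewrite ?t0 ?N0.
- apply: (S (fun i => [:: (i.+1, Max d); (i, Cross b); (i.+1, Min)]) (fun _ => [::])) => // f c s1 s2.
  case: c => [|[x m] c] //=; case: d; case: x => //= _ _; case: m; case: b;
  by rewrite /= /alpha /beta /Rw /Rp /mu /zz /=; field; rewrite ?t0 ?N0.
- apply: (S (fun i => [:: (i, Max d); (i.+1, Cross b); (i, Min)]) (fun _ => [::])) => // f c s1 s2.
  case: c => [|[x m] c] //=; case: d; case: x => //= _ _; case: m; case: b;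
  by rewrite /= /alpha /beta /Rw /Rp /mu /zz /=; field; rewrite ?t0 ?N0.
- apply: (S (fun i => [:: (i, Cross b); (i, Cross (~~ b))]) (fun _ => [::])) => // f c s1 s2.
  case: c => [|[x m] [|[y n] c]] //= _ _.
  by case: b; case: x; case: y; case: m; case: n; rewrite /= /Rw /Rp /mu /zz /=; field; rewrite ?t0 ?N0.
- apply: (S (fun i => [:: (i, Cross b); (i.+1, Cross b); (i, Cross b)])
            (fun i => [:: (i.+1, Cross b); (i, Cross b); (i.+1, Cross b)])) => // f c s1 s2.
  case: c => [|[x m] [|[y n] [|[x' m'] c]]] //= _ _.
  by case: b; case: x; case: y; case: m; case: n; case: x'; case: m'; rewrite /= /Rw /Rp /mu /zz /=; field; rewrite ?t0 ?N0.
- apply: (S (fun i => [:: (i, Max d); (i.+1, Cross b)])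
            (fun i => [:: (i.+1, Max d); (i, Cross (~~ b))])) => // f c s1 s2.
  case: c => [|[x m] c] //= _ _.
  by case: b; case: d; case: x; case: m; rewrite /= /alpha /Rw /Rp /mu /zz /=; field; rewrite ?t0 ?N0.
- apply: (S (fun i => [:: (i.+1, Cross b); (i, Min)])
            (fun i => [:: (i, Cross (~~ b)); (i.+1, Min)])) => // f c s1 s2.
  case: c => [|[x m] [|[y n] [|[x' m'] c]]] //=.
  case: x; case: x' => //=; case: y => //= _ _.
  all: by case: b; case: m; case: n; case: m'; rewrite /= /beta /Rw /Rp /mu /zz /=; field; rewrite ?t0 ?N0.
Qed.

Lemma pulls_cat u w f c : pulls (u ++ w) f c = pulls u (pulls w f) c.
Proof. by elim: u c => [|[i e] u IH] c //=; apply: pull_fext. Qed.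

Definition eval (w : seq slice) : F :=
  if w is (_, Max d) :: w' then
    pulls w' base [:: (d, false); (~~ d, false)] / beta d false
  else 0.

Lemma cup_exchange d e v :
  run v [:: d; ~~ d; e; ~~ e] = Some [::] ->
  eval [:: (0, Max d), (2, Max e) & v]%N = eval [:: (0, Max e), (0, Max d) & v]%N.
Proof.
move=> R /=; set f := pulls v base.
have A h i j k l : act h f [:: (d, i); (~~ d, j); (e, k); (~~ e, l)] = 0.
  exact: act_pulls.
have N0 : - t != 0 by rewrite oppr_eq0.
have := A d true false false false.
have := A (~~ d) false false (d (+) e) (~~ (d (+) e)).
move: (f) => f'; clear -t0 N0; case: d; case: e.
all: rewrite /= /flip_coef /kk /mu /alpha /beta /= => A2 A1.
all: have E (a b x y : F) : x = 0 -> y = 0 -> a * x - b * y = 0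
  by move=> -> ->; rewrite !mulr0 subr0.
all: apply/eqP; rewrite -subr_eq0; apply/eqP.
- by apply: (etrans _ (E t^-1 t^-1 _ _ A2 A1)); field; rewrite ?t0 ?N0 ?oner_eq0.
- by apply: (etrans _ (E t^-1 1 _ _ A2 A1)); field; rewrite ?t0 ?N0 ?oner_eq0.
- by apply: (etrans _ (E 1 t^-1 _ _ A2 A1)); field; rewrite ?t0 ?N0 ?oner_eq0.
- by apply: (etrans _ (E 1 1 _ _ A2 A1)); field; rewrite ?t0 ?N0 ?oner_eq0.
Qed.

Lemma pulls_lin w a b f g c :
  pulls w (fun c' => a * f c' + b * g c') c = a * pulls w f c + b * pulls w g c.
Proof.
elim: w c => [|[i e] w IH] c //=; rewrite -pull_lin.
by apply: pull_fext => c'; apply: IH.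
Qed.

Lemma skein_pull s1 d s2 f c : dirs c = s1 ++ [:: d, d & s2] ->
  pull (size s1) (Cross true) f c - pull (size s1) (Cross false) f c = zz * f c.
Proof.
elim: s1 f c => [|x s1 IH] f [|[y n] c] //=; last by case=> _ /IH ->.
case: c => [|[x m] c] //= [-> -> _].
by case: d; case: m; case: n; rewrite /= /Rw /Rp /zz /=; field; rewrite ?t0.
Qed.

Lemma run_good l r f c s1 s2 v :
  good l r -> run (l ++ v) (dirs c) = Some s1 -> run (r ++ v) (dirs c) = Some s2 ->
  pulls l f c = pulls r f c.
Proof.
rewrite !run_cat => G.
case E1: (run l _) => [u1|] // _; case E2: (run r _) => [u2|] // _.
exact: G E1 E2.
Qed.

Lemma eval_cons u v v' : u <> [::] -> run (u ++ v) [::] = Some [::] ->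
  (forall s, run u [::] = Some s -> forall c, dirs c = s -> pulls v base c = pulls v' base c) ->
  eval (u ++ v) = eval (u ++ v').
Proof.
case: u => [|[[|i] [d||b]] u] //= _ R H; congr (_ / _).
rewrite !pulls_cat; move: R; rewrite run_cat.
case E: run => [s|] //= R; apply: (pulls_ext (s := s)) => //.
exact: H.
Qed.

Lemma eval_move l r u v : move l r ->
  run (u ++ l ++ v) [::] = Some [::] -> run (u ++ r ++ v) [::] = Some [::] ->
  eval (u ++ l ++ v) = eval (u ++ r ++ v).
Proof.
move=> M R1 R2; have [_ G] := good_move M.
case: u R1 R2 => [|x u] R1 R2; last first.
  apply: eval_cons => // s E c Ec; rewrite !pulls_cat.
  move: R1 R2; rewrite !run_cat E /= -Ec => R1 R2.
  exact: run_good G R1 R2.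
case: M R1 R2 {G} => [i k e f|i d|i d|i d b|i d b|i b|i b|i d b|i b]; case: i => //=.
case: e => [d||b] //; case: k => // ; case: f => // e /=.
by move=> R _; apply: cup_exchange.
Qed.

Definition model (L : link) : F := eval L.

Lemma model_isotopic L L' : isotopic L L' -> model L = model L'.
Proof.
elim=> {L L'} [L L' [u [l [r [v [M E E']]]]] | // | L L' _ -> // | L1 L2 L3 _ -> _ -> //].
rewrite /model; move: (eqP (slicesP L)) (eqP (slicesP L')).
by rewrite E E'; apply: eval_move.
Qed.

Lemma model_unknot : model unknot = 1.
Proof. by rewrite /model /= /base /beta /mu /= mulr1 divff. Qed.

Lemma model_skein Lp Lm L0 : skein_triple Lp Lm L0 ->
  model Lp - model Lm = zz * model L0.
Proof.
case=> u [s1 [d [s2 [v [E Ep Em E0]]]]]; rewrite /model Ep Em E0.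
case: u E {Ep Em E0} => [|[[|i] [e||b]] u] //=; first by case: s1.
move=> E; rewrite -mulrBl mulrA; congr (_ / _); rewrite !pulls_cat.
rewrite -[X in X - _]mul1r -mulN1r -pulls_lin.
rewrite -[RHS]addr0 -[X in _ = _ + X](mul0r (pulls u (pulls v base)
  [:: (e, false); (~~ e, false)])) -pulls_lin.
apply: (pulls_ext (c := [:: (e, false); (~~ e, false)]) E) => c Ec.
by rewrite mul1r mulN1r mul0r addr0; apply: skein_pull Ec.
Qed.
End Model.

End GL11.

Lemma alexander_exists : exists Delta, is_alexander Delta.
Proof.
have t0 : qhalf != 0 by rewrite tofrac_eq0 polyX_eq0.
exists (@GL11.model _ qhalf); split.
- exact: GL11.model_isotopic.
- exact: GL11.model_unknot.
- exact: GL11.model_skein.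
Qed.

(* Main.v *)
Require Import Defs.
From mathcomp Require Import all_boot all_order all_algebra.
From mathcomp Require Import ring.
Set Implicit Arguments.
Unset Strict Implicit.
Unset Printing Implicit Defensive.
Import GRing.Theory.
Local Open Scope ring_scope.

(** The Alexander polynomial of a link containing a tangle T with strands in at
    NW, SE and out at NE, SW depends on T only through two coefficients: the
    skein relation and isotopy rewrite T, inside any link, as a combination
    a I + b E of the tangle I of two vertical strands and the tangle E made of
    a minimum above a maximum ([expands]).  Both closures of I and E are an
    unknot or a two-component unlink, with values 1 and 0, and one finds that a
    is the value of the numerator closure and b that of the denominator closure
    ([expands_numerator], [expands_denominator]), so the q-fraction is a / b.

    Placing tangles side by side therefore adds fractions, and stacking them
    adds the inverses of fractions ([expands_sum], [expands_stack]); both rely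
    on the vanishing of a diagram with a split circle ([circle0]).  Two
    crossings give the fractions z, - z ([expands_z]) and 1 / z, - 1 / z
    ([expands_inv_z]).

    With t = q^(1/2), the function to be realized equals
    z^3 + (5 - g) z + r_(a_1) + ... + r_(a_k), where
    r_n = t (1 - (- q)^(n-1)) / (1 - (- q)^n)
    ([poincare_decomposition]).  Sums of z and - z are available; z^3 comes from
    the identity [cube_quotient]; and r_1 = 0, r_2 = 1 / z,
    1 / r_(n+2) = z + 1 / (z + r_n), which is a continued fraction with all its
    entries equal to z ([branch_rec]). *)

(** * Nonvanishing in the field of values *)

Lemma qhalf_neq0 : qhalf != 0.
Proof. by rewrite tofrac_eq0 polyX_eq0. Qed.

(** The polynomial on the left takes the value 1 at the origin. *)
Lemma one_sub_Nq_exp_neq0 n : (0 < n)%N -> 1 - (- q) ^+ n != 0.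
Proof.
case: n => // n _; rewrite /q /qhalf.
have -> : 1 - (- tofrac 'X ^+ 2) ^+ n.+1
    = tofrac (1 - (- 'X ^+ 2) ^+ n.+1) :> ratfun.
  by rewrite rmorphB rmorph1 rmorphXn rmorphN rmorphXn.
rewrite tofrac_eq0; apply/eqP => /(congr1 (horner^~ 0)) /eqP.
by rewrite !(hornerD, hornerN, horner_exp, hornerX, hornerC) !(expr0n, oppr0)
  subr0 oner_eq0.
Qed.

Lemma one_add_q_neq0 : 1 + q != 0.
Proof. by have := @one_sub_Nq_exp_neq0 1 isT; rewrite expr1 opprK. Qed.

Lemma z_neq0 : z != 0.
Proof.
have := @one_sub_Nq_exp_neq0 2 isT; apply: contraNneq => z0.
have : qhalf * z = 1 - q by rewrite /z mulrBr divff ?qhalf_neq0.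
by rewrite z0 mulr0 sqrrN => /esym/subr0_eq <-; rewrite expr1n subrr.
Qed.

(** * Links containing a fixed exterior *)

Definition raise n (w : seq slice) : seq slice := iter n shift w.

Lemma raise_cat n w1 w2 : raise n (w1 ++ w2) = raise n w1 ++ raise n w2.
Proof. by elim: n => //= n ->; rewrite /shift map_cat. Qed.

Lemma raise_cons n i e w :
  raise n ((i, e) :: w) = ((n + i)%N, e) :: raise n w.
Proof. by elim: n => //= n ->. Qed.

Lemma run_raise w p s r t :
  run w s = Some t -> run (raise (size p) w) (p ++ s ++ r) = Some (p ++ t ++ r).
Proof.
by move=> R; elim: p => [|x p IH]; [exact: run_rcat R | exact: run_shift IH].
Qed.

Lemma run_insert u v w s0 p s r t : run u s0 = Some (p ++ s ++ r) ->
  run w s = Some t ->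
  run (u ++ raise (size p) w ++ v) s0 = run v (p ++ t ++ r).
Proof. by move=> Ru Rw; rewrite run_cat Ru [LHS]run_cat (run_raise p r Rw). Qed.

Lemma move_raise n l r : move l r -> move (raise n l) (raise n r).
Proof.
move=> M; elim: n => //= n; case=> {l r M} *; [exact: Mexch | exact: Mzigl
  | exact: Mzigr | exact: MR1r | exact: MR1l | exact: MR2 | exact: MR3
  | exact: Mmax | exact: Mmin].
Qed.

Section Skein.
Context (Delta : link -> ratfun) (DeltaP : is_alexander Delta).

(** Extending an invariant of links by 0 to arbitrary words avoids carrying
    well-formedness proofs through the rewriting of diagrams. *)
Definition value (w : seq slice) : ratfun :=
  if @idP (run w [::] == Some [::]) is ReflectT p
  then Delta (Diagram p) else 0.

Lemma value_link (L : link) : value (slices L) = Delta L.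
Proof.
case: L => w p; rewrite /value /=; case: {-}_ / idP => [p'|/(_ p)] //.
by rewrite (eq_irrelevance p' p).
Qed.

Lemma value_run w : run w [::] = Some [::] ->
  exists2 L : link, slices L = w & value w = Delta L.
Proof.
by move=> /eqP R; exists (Diagram R); rewrite // -value_link.
Qed.

(** A tangle from [s] to [t] is studied through the values of all links that
    contain it: [f] is such an evaluation when it inserts the tangle between [u]
    and [v], with strands [p] on its left and [r] on its right. *)
Definition context s t (f : seq slice -> ratfun) : Prop :=
  exists u p r v, [/\ run u [::] = Some (p ++ s ++ r),
                      run v (p ++ t ++ r) = Some [::]
                    & forall w, f w = value (u ++ raise (size p) w ++ v)].

Lemma context_after a s s' t f : context s t f -> run a s = Some s' ->
  context s' t (fun w => f (a ++ w)).
Proof.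
move=> [u [p [r [v [Ru Rv Ef]]]]] Ra.
exists (u ++ raise (size p) a), p, r, v; split=> // [|w].
  by rewrite run_cat Ru [LHS](run_raise _ _ Ra).
by rewrite Ef raise_cat -!catA.
Qed.

Lemma context_before b s t t' f : context s t f -> run b t' = Some t ->
  context s t' (fun w => f (w ++ b)).
Proof.
move=> [u [p [r [v [Ru Rv Ef]]]]] Rb.
exists u, p, r, (raise (size p) b ++ v); split=> // [|w].
  by rewrite run_cat (run_raise _ _ Rb).
by rewrite Ef raise_cat -!catA.
Qed.

Lemma context_beside p r s t f : context (p ++ s ++ r) (p ++ t ++ r) f ->
  context s t (fun w => f (raise (size p) w)).
Proof.
move=> [u [p0 [r0 [v [Ru Rv Ef]]]]].
exists u, (p0 ++ p), (r ++ r0), v; split=> [||w].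
- by rewrite Ru -!catA.
- by rewrite -Rv -!catA.
- by rewrite Ef size_cat /raise iterD.
Qed.

Lemma context_move s t f a l r b : context s t f -> move l r ->
  run (a ++ l ++ b) s = Some t -> run (a ++ r ++ b) s = Some t ->
  f (a ++ l ++ b) = f (a ++ r ++ b).
Proof.
move=> [u [p0 [r0 [v [Ru Rv Ef]]]]] M Rl Rr; rewrite !Ef.
have R w : run w s = Some t ->
    run (u ++ raise (size p0) w ++ v) [::] = Some [::].
  by move=> Rw; rewrite (run_insert _ Ru Rw).
have [L EL ->] := value_run (R _ Rl); have [L' EL' ->] := value_run (R _ Rr).
case: DeltaP => I _ _; apply/I/Relation_Operators.rst_step.
exists (u ++ raise (size p0) a), (raise (size p0) l), (raise (size p0) r),
  (raise (size p0) b ++ v).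
by split; [exact: move_raise | rewrite EL | rewrite EL'];
  rewrite !raise_cat -!catA.
Qed.

Lemma context_moveV s t f a l r b : context s t f -> move l r ->
  run (a ++ l ++ b) s = Some t -> run (a ++ r ++ b) s = Some t ->
  f (a ++ r ++ b) = f (a ++ l ++ b).
Proof. by move=> C M Rl Rr; rewrite (context_move C M Rl Rr). Qed.

Lemma context_skein s t f a p d r b : context s t f ->
  run a s = Some (p ++ [:: d; d] ++ r) ->
  run b (p ++ [:: d; d] ++ r) = Some t ->
  f (a ++ (size p, Cross true) :: b) - f (a ++ (size p, Cross false) :: b)
  = z * f (a ++ b).
Proof.
move=> [u [p0 [r0 [v [Ru Rv Ef]]]]] Ra Rb; rewrite !Ef.
have RC c : run ((size p, Cross c) :: b) (p ++ [:: d; d] ++ r) = Some t.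
  rewrite -Rb /=; set X := slice_step _ _ _.
  suff -> : X = Some (p ++ [:: d; d] ++ r) by [].
  by rewrite /X; elim: (p) => //= x p1 ->.
have R w : run w s = Some t ->
    run (u ++ raise (size p0) w ++ v) [::] = Some [::].
  by move=> Rw; rewrite (run_insert _ Ru Rw).
have [|Lp Ep ->] := @value_run
  (u ++ raise (size p0) (a ++ (size p, Cross true) :: b) ++ v).
  by apply: R; rewrite run_cat Ra; exact: RC.
have [|Lm Em ->] := @value_run
  (u ++ raise (size p0) (a ++ (size p, Cross false) :: b) ++ v).
  by apply: R; rewrite run_cat Ra; exact: RC.
have [|L0 E0 ->] := @value_run (u ++ raise (size p0) (a ++ b) ++ v).
  by apply: R; rewrite run_cat Ra.
case: DeltaP => _ _; apply.
exists (u ++ raise (size p0) a), (p0 ++ p), d, (r ++ r0),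
  (raise (size p0) b ++ v).
split.
- by rewrite run_cat Ru [LHS](run_raise _ _ Ra) -!catA.
- by rewrite Ep raise_cat raise_cons size_cat -!catA.
- by rewrite Em raise_cat raise_cons size_cat -!catA.
- by rewrite E0 raise_cat -!catA.
Qed.

(* Apply the move [m] between the slices [a] above and [b] below it to the
   left-hand side of the goal, [C] being the context; [slide_back] applies the
   move from right to left. *)
Ltac slide C a m b :=
  refine (etrans (@context_move _ _ _ a _ _ b C m erefl erefl) _); rewrite /= .
Ltac slide_back C a m b :=
  refine (etrans (@context_moveV _ _ _ a _ _ b C m erefl erefl) _); rewrite /= .

Local Open Scope nat_scope.

(** * Kinks and circles *)

(** The orientation of a maximum is reversed by adding a kink.  Turaev's moves
    only include the kink on a vertical strand; it is inserted on the left leg,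
    and the extrema of the kink and the original maximum then cancel except for
    one maximum of the other orientation. *)
Lemma flip_max d f : context [::] [:: d; ~~ d] f ->
  f [:: (0, Max d)] = f [:: (0, Max (~~ d)); (0, Cross true)].
Proof.
case: d => C.
- slide_back C [:: (0, Max dn)] (MR1l 0 up false) (@nil slice).
  slide_back C (@nil slice) (Mexch 0 0 (Max up) (Max dn))
    [:: (1, Cross false); (0, Min)].
  slide_back C [:: (0, Max up)] (Mmax 1 dn true) [:: (0, Min)].
  slide_back C [:: (0, Max up); (1, Max dn)] (Mexch 0 0 Min (Cross true))
    (@nil slice).
  by slide C [:: (0, Max up)] (Mzigr 0 dn) [:: (0, Cross true)].
- slide_back C [:: (0, Max up)] (MR1l 0 dn false) (@nil slice).
  slide_back C (@nil slice) (Mexch 0 0 (Max dn) (Max up))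
    [:: (1, Cross false); (0, Min)].
  slide_back C [:: (0, Max dn)] (Mmax 1 up true) [:: (0, Min)].
  slide_back C [:: (0, Max dn); (1, Max up)] (Mexch 0 0 Min (Cross true))
    (@nil slice).
  by slide C [:: (0, Max dn)] (Mzigr 0 up) [:: (0, Cross true)].
Qed.

(** The same computation upside down. *)
Lemma flip_min x c f : context [:: x; ~~ x] [::] f ->
  f [:: (0, Cross c); (0, Min)] = f [:: (0, Min)].
Proof.
case: x => C; symmetry.
- slide_back C (@nil slice) (MR1l 0 up (~~ c)) [:: (0, Min)].
  slide C [:: (0, Max up); (1, Cross (~~ c))] (Mexch 0 0 Min Min) (@nil slice).
  slide_back C [:: (0, Max up)] (Mmin 1 c) [:: (0, Min)].
  slide C (@nil slice) (Mexch 0 0 (Max up) (Cross c)) [:: (1, Min); (0, Min)].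
  by slide C [:: (0, Cross c)] (Mzigl 0 up) [:: (0, Min)].
- slide_back C (@nil slice) (MR1l 0 dn (~~ c)) [:: (0, Min)].
  slide C [:: (0, Max dn); (1, Cross (~~ c))] (Mexch 0 0 Min Min) (@nil slice).
  slide_back C [:: (0, Max dn)] (Mmin 1 c) [:: (0, Min)].
  slide C (@nil slice) (Mexch 0 0 (Max dn) (Cross c)) [:: (1, Min); (0, Min)].
  by slide C [:: (0, Cross c)] (Mzigl 0 dn) [:: (0, Min)].
Qed.

Lemma flip_circle d f : context [::] [::] f ->
  f [:: (0, Max d); (0, Min)] = f [:: (0, Max (~~ d)); (0, Min)].
Proof.
move=> C.
have C1 : context [::] [:: d; ~~ d] (fun w => f (w ++ [:: (0, Min)])).
  by apply: (context_before C); case: (d).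
have C2 := context_after (a := [:: (0, Max (~~ d))]) C erefl.
by rewrite [LHS](flip_max C1) [LHS](flip_min true C2).
Qed.

(** If the strand and the near side of the circle are parallel, the two ways of
    making them cross both give a strand with a kink; so the skein relation
    shows that z times the value is 0.  Otherwise the circle is reversed. *)
Lemma circle0 x d f : context [:: x] [:: x] f ->
  f [:: (1, Max d); (1, Min)] = 0%R.
Proof.
move=> C; suff H : f [:: (1, Max x); (1, Min)] = 0%R.
  have [-> //|->] : d = x \/ d = ~~ x by case: (x); case: (d); auto.
  have C1 := context_beside (p := [:: x]) (s := [::]) (t := [::]) (r := [::]) C.
  by rewrite [LHS](flip_circle (~~ x) C1) negbK.
apply: (mulfI z_neq0); rewrite mulr0.
have K b : f [:: (1, Max x); (0, Cross b); (1, Min)] = f [::].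
  case: x C => C.
  - by slide C (@nil slice) (MR1r 0 dn b) (@nil slice).
  - by slide C (@nil slice) (MR1r 0 up b) (@nil slice).
have <- : (f [:: (1, Max x); (0, Cross true); (1, Min)]
   - f [:: (1, Max x); (0, Cross false); (1, Min)]
   = z * f [:: (1, Max x); (1, Min)])%R.
  apply: (@context_skein _ _ _ [:: (1, Max x)] [::] x [:: ~~ x]
    [:: (1, Min)] C);
  by case: (x).
by rewrite !K subrr.
Qed.

(** * Expansion of tangles *)

(** Rotating the crossing by a quarter turn makes its strands parallel, and
    exchanges the two values of [b], whence the order of the two terms. *)
Lemma antiparallel_skein x f : context [:: x; ~~ x] [:: ~~ x; x] f ->
  (f [:: (0, Cross false)] - f [:: (0, Cross true)]
   = z * f [:: (0, Min); (0, Max (~~ x))])%R.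
Proof.
move=> C.
have K b : f [:: (0, Cross b)]
    = f [:: (0, Max (~~ x)); (1, Cross (~~ b)); (2, Min)].
  case: x C => C.
  - slide_back C [:: (0, Cross b)] (Mzigl 0 up) (@nil slice).
    slide_back C (@nil slice) (Mexch 0 0 (Max up) (Cross b)) [:: (1, Min)].
    by slide C [:: (0, Max up)] (Mmin 1 b) (@nil slice).
  - slide_back C [:: (0, Cross b)] (Mzigl 0 dn) (@nil slice).
    slide_back C (@nil slice) (Mexch 0 0 (Max dn) (Cross b)) [:: (1, Min)].
    by slide C [:: (0, Max dn)] (Mmin 1 b) (@nil slice).
have <- : f [:: (0, Max (~~ x)); (2, Min)] = f [:: (0, Min); (0, Max (~~ x))].
  case: x C K => C K.
  - by slide C (@nil slice) (Mexch 0 0 (Max up) Min) (@nil slice).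
  - by slide C (@nil slice) (Mexch 0 0 (Max dn) Min) (@nil slice).
rewrite !K /=.
by apply: (@context_skein _ _ _ [:: (0, Max (~~ x))] [:: ~~ x] x [:: ~~ x]
  [:: (2, Min)] C); case: (x).
Qed.

(** Equality with a combination of the two crossingless tangles, in the skein
    module of tangles. *)
Definition expands (w : seq slice) (a b : ratfun) : Prop :=
  forall f, context [:: dn; up] [:: dn; up] f ->
  f w = (a * f [::] + b * f [:: (0%N, Min); (0%N, Max dn)])%R.

Lemma expands_0 : expands [:: (0, Min); (0, Max dn)] 0%R 1%R.
Proof. by move=> f _; rewrite mul1r mul0r add0r. Qed.

(** Stacking E on itself creates a split circle, so that E squares to 0 while I
    is the unit: the coefficients multiply as dual numbers. *)
Lemma expands_stack (T1 T2 : tangle2) a1 b1 a2 b2 :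
  expands T1 a1 b1 -> expands T2 a2 b2 ->
  expands (T1 ++ T2) (a1 * a2)%R (a1 * b2 + b1 * a2)%R.
Proof.
move=> E1 E2 f C.
have R2 := eqP (slicesP T2).
rewrite [LHS](E1 _ (context_before C R2)) /= (E2 _ C).
have C' := context_after (a := [:: (0, Min); (0, Max dn)]) C erefl.
rewrite [f [:: _, _ & _]](E2 _ C').
have -> : f ([:: (0, Min); (0, Max dn)] ++ [:: (0, Min); (0, Max dn)]) = 0%R.
  slide_back C [:: (0, Min); (0, Max dn)] (Mexch 0 0 (Max dn) Min) (@nil slice).
  slide_back C [:: (0, Min)] (Mexch 0 0 (Max dn) (Max dn)) [:: (2, Min)].
  have C1 := context_beside (p := [:: dn]) (s := [:: up]) (t := [:: up])
    (r := [::]) C'.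
  exact: (circle0 dn C1).
by rewrite mulr0 addr0 !mulrDr !mulrA mulrDl addrA [(b1 * _)%R]mulrC.
Qed.

(** For the side by side product E is the unit, and I times I is I with a split
    circle. *)
Lemma expands_sum (T1 T2 : tangle2) a1 b1 a2 b2 :
  expands T1 a1 b1 -> expands T2 a2 b2 ->
  expands ((1, Max up) :: T1 ++ raise 2 T2 ++ [:: (1, Min)])
    (a1 * b2 + b1 * a2)%R (b1 * b2)%R.
Proof.
move=> E1 E2 f C.
have R1 := run_raise [::] [:: dn; up] (eqP (slicesP T1)).
have R2 := run_raise [:: dn; up] [::] (eqP (slicesP T2)).
have C0 := context_after (a := [:: (1, Max up)]) C erefl.
have CM := context_before (b := [:: (1, Min)])
  (t' := [:: dn; up; dn; up]) C0 erefl.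
have C1 := context_beside (p := [::]) (s := [:: dn; up]) (r := [:: dn; up])
  (context_before CM R2).
have C2 w : run w [:: dn; up; dn; up] = Some [:: dn; up; dn; up] ->
   context [:: dn; up] [:: dn; up]
     (fun w2 => f ((1, Max up) :: (w ++ raise 2 w2) ++ [:: (1, Min)])).
  move=> Rw; exact: (context_beside (p := [:: dn; up]) (s := [:: dn; up])
    (t := [:: dn; up]) (r := [::]) (context_after CM Rw)).
rewrite -[raise 2 T2 ++ _]cat0s catA.
have := E1 _ C1; rewrite /= -!catA => ->.
have := E2 _ (C2 [::] erefl); rewrite /= => ->.
have := E2 _ (C2 [:: (0, Min); (0, Max dn)] erefl); rewrite /= => ->.
have -> : f [:: (1, Max up); (1, Min)] = 0%R.
  exact: (circle0 up (context_beside (p := [::]) (s := [:: dn]) (t := [:: dn])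
    (r := [:: up]) C)).
have -> : f [:: (1, Max up); (2, Min); (2, Max dn); (1, Min)] = f [::].
  slide C (@nil slice) (Mzigl 1 up) [:: (2, Max dn); (1, Min)].
  by slide C (@nil slice) (Mzigr 1 dn) (@nil slice).
have -> : f [:: (1, Max up); (0, Min); (0, Max dn); (1, Min)] = f [::].
  slide C (@nil slice) (Mzigr 0 up) [:: (0, Max dn); (1, Min)].
  by slide C (@nil slice) (Mzigl 0 dn) (@nil slice).
have -> : f [:: (1, Max up); (0, Min); (0, Max dn);
                (2, Min); (2, Max dn); (1, Min)]
    = f [:: (0, Min); (0, Max dn)].
  slide C (@nil slice) (Mzigr 0 up)
    [:: (0, Max dn); (2, Min); (2, Max dn); (1, Min)].
  slide C [:: (0, Max dn); (2, Min)] (Mzigr 1 dn) (@nil slice).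
  by slide C (@nil slice) (Mexch 0 0 (Max dn) Min) (@nil slice).
by rewrite mulr0 add0r !mulrDr !mulrA mulrDl addrA.
Qed.

(** Two strands twisted around each other by a full turn; changing one crossing
    untwists them, smoothing it leaves E with a kink. *)
Lemma expands_inv_z b : expands [:: (0, Cross b); (0, Cross b)]
  1%R (if b then - z else z)%R.
Proof.
move=> f C.
have S := antiparallel_skein (context_after (a := [:: (0, Cross b)])
  (s' := [:: up; dn]) C erefl).
have R : f [:: (0, Cross b); (0, Cross (~~ b))] = f [::].
  by slide C (@nil slice) (MR2 0 b) (@nil slice).
have F : f [:: (0, Cross b); (0, Min); (0, Max dn)]
    = f [:: (0, Min); (0, Max dn)].
  exact: (flip_min b (context_before (b := [:: (0, Max dn)]) (t' := [::])
    C erefl)).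
move: S; rewrite /= F mul1r; case: b R {F} => /= -> S.
- by rewrite mulNr -S opprB addrC subrK.
- by rewrite -S addrC subrK.
Qed.

(** The two arcs of E, clasped: a changed crossing lets them slide apart, a
    smoothed one gives I with a kink. *)
Lemma expands_z b :
  expands [:: (1, Max dn); (0, Cross b); (2, Cross b); (1, Min)]
    (if b then z else - z)%R 1%R.
Proof.
move=> f C.
have S : (f [:: (1, Max dn); (0, Cross true); (2, Cross b); (1, Min)]
   - f [:: (1, Max dn); (0, Cross false); (2, Cross b); (1, Min)]
   = z * f [:: (1, Max dn); (2, Cross b); (1, Min)])%R.
  exact: (@context_skein _ _ _ [:: (1, Max dn)] [::] dn [:: up; up]
    [:: (2, Cross b); (1, Min)] C).
have R : f [:: (1, Max dn); (2, Cross b); (1, Min)] = f [::].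
  by slide C (@nil slice) (MR1l 1 dn b) (@nil slice).
have F : f [:: (1, Max dn); (0, Cross (~~ b)); (2, Cross b); (1, Min)]
    = f [:: (0, Min); (0, Max dn)].
  slide_back C (@nil slice) (Mmax 0 dn b) [:: (2, Cross b); (1, Min)].
  slide C [:: (0, Max dn); (1, Cross b)] (Mmin 1 b) (@nil slice).
  slide C [:: (0, Max dn)] (MR2 1 b) [:: (2, Min)].
  by slide C (@nil slice) (Mexch 0 0 (Max dn) Min) (@nil slice).
move: S; rewrite R mul1r -F; case: b {R F} => /= S.
- by rewrite -S subrK.
- by rewrite mulNr -S opprB subrK.
Qed.

(** * Coefficients and closures *)

Lemma expands_numerator (T : tangle2) a b :
  expands T a b -> Delta (numerator T) = a.
Proof.
move=> E; rewrite -value_link /=.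
have C : context [::] [::] value.
  by exists [::], [::], [::], [::]; split=> // w; rewrite cats0.
have C1 := context_before (b := [:: (0, Min)]) (t' := [:: dn; up])
   (context_after (a := [:: (0, Max dn)]) C erefl) erefl.
rewrite [LHS](E _ C1) /=.
have -> : value [:: (0, Max dn); (0, Min)] = 1%R.
  by case: DeltaP => _ <- _; rewrite -value_link.
suff -> : value [:: (0, Max dn); (0, Min); (0, Max dn); (0, Min)] = 0%R.
  by rewrite mulr1 mulr0 addr0.
slide_back C [:: (0, Max dn)] (Mexch 0 0 (Max dn) Min) [:: (0, Min)].
slide_back C (@nil slice) (Mexch 0 0 (Max dn) (Max dn)) [:: (2, Min); (0, Min)].
exact: (circle0 dn (context_beside (p := [:: dn]) (s := [:: up]) (t := [:: up])
    (r := [::]) C1)).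
Qed.

Lemma expands_denominator (T : tangle2) a b :
  expands T a b -> Delta (denominator T) = b.
Proof.
move=> E; rewrite -value_link /=.
have C : context [::] [::] value.
  by exists [::], [::], [::], [::]; split=> // w; rewrite cats0.
have C1 := context_before (b := [:: (0, Min); (0, Min)])
   (t' := [:: up; dn; up; dn])
   (context_after (a := [:: (0, Max up); (2, Max up)]) C erefl) erefl.
have C2 := context_beside (p := [:: up]) (s := [:: dn; up]) (t := [:: dn; up])
   (r := [:: dn]) C1.
rewrite [LHS](E _ C2) /=.
have -> : value [:: (0, Max up); (2, Max up); (1, Min);
                    (1, Max dn); (0, Min); (0, Min)] = 1%R.
  slide C [:: (0, Max up)] (Mzigr 1 up) [:: (1, Max dn); (0, Min); (0, Min)].
  slide C [:: (0, Max up)] (Mzigr 0 dn) [:: (0, Min)].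
  rewrite [LHS](flip_circle up C).
  by case: DeltaP => _ <- _; rewrite -value_link.
suff -> : value [:: (0, Max up); (2, Max up); (0, Min); (0, Min)] = 0%R.
  by rewrite mulr1 mulr0 add0r.
slide C [:: (0, Max up); (2, Max up)] (Mexch 0 0 Min Min) (@nil slice).
have C3 := context_before (b := [:: (0, Min)])
   (t' := [:: up; dn]) (context_after (a := [:: (0, Max up)]) C erefl) erefl.
exact: (circle0 up (context_beside (p := [:: up]) (s := [:: dn]) (t := [:: dn])
    (r := [::]) C3)).
Qed.
End Skein.

(** * Fractions realized by tangles *)

Lemma stackP (T1 T2 : tangle2) :
  run (T1 ++ T2) [:: dn; up] == Some [:: dn; up].
Proof. by rewrite run_cat (eqP (slicesP T1)) /= (slicesP T2). Qed.

Lemma sumP (T1 T2 : tangle2) :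
  run ((1, Max up) :: T1 ++ raise 2 T2 ++ [:: (1, Min)])%N [:: dn; up]
  == Some [:: dn; up].
Proof.
have R1 := run_raise [::] [:: dn; up] (eqP (slicesP T1)).
have R2 := run_raise [:: dn; up] [::] (eqP (slicesP T2)).
by rewrite /= run_cat [run T1 _]R1 /= run_cat [run (raise 2 T2) _]R2.
Qed.

(** The coefficients of one tangle, valid for every normalized Alexander
    polynomial. *)
Definition coefficients a b : Prop := exists T : tangle2,
  forall Delta, is_alexander Delta -> expands Delta T a b.

Lemma coefficients_stack a1 b1 a2 b2 :
  coefficients a1 b1 -> coefficients a2 b2 ->
  coefficients (a1 * a2) (a1 * b2 + b1 * a2).
Proof.
move=> [T1 E1] [T2 E2]; exists (Diagram (stackP T1 T2)) => Delta DP.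
exact: expands_stack (E1 _ DP) (E2 _ DP).
Qed.

Lemma coefficients_sum a1 b1 a2 b2 :
  coefficients a1 b1 -> coefficients a2 b2 ->
  coefficients (a1 * b2 + b1 * a2) (b1 * b2).
Proof.
move=> [T1 E1] [T2 E2]; exists (Diagram (sumP T1 T2)) => Delta DP.
exact: expands_sum (E1 _ DP) (E2 _ DP).
Qed.

Lemma coefficients_0 : coefficients 0 1.
Proof.
exists (@Diagram [:: dn; up] [:: dn; up] [:: (0, Min); (0, Max dn)]%N isT).
by move=> Delta _; apply: expands_0.
Qed.

Lemma coefficients_z b : coefficients (if b then z else - z) 1.
Proof.
exists (@Diagram [:: dn; up] [:: dn; up]
  [:: (1, Max dn); (0, Cross b); (2, Cross b); (1, Min)]%N isT).
by move=> Delta DP; apply: expands_z.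
Qed.

Lemma coefficients_inv_z b : coefficients 1 (if b then - z else z).
Proof.
exists (@Diagram [:: dn; up] [:: dn; up] [:: (0, Cross b); (0, Cross b)]%N isT).
by move=> Delta DP; apply: expands_inv_z.
Qed.

Definition is_fraction (x : ratfun) : Prop :=
  exists a b, [/\ coefficients a b, b != 0 & a / b = x].

Lemma fraction0 : is_fraction 0.
Proof.
exists 0, 1; split; [exact: coefficients_0 | exact: oner_neq0 | exact: mul0r].
Qed.

Lemma fraction_z : is_fraction z.
Proof.
exists z, 1; split; [exact: coefficients_z true | exact: oner_neq0
  | exact: divr1].
Qed.

Lemma fraction_Nz : is_fraction (- z).
Proof.
exists (- z), 1; split; [exact: coefficients_z false | exact: oner_neq0
  | exact: divr1].
Qed.

Lemma sum_quotient (F : fieldType) (a1 b1 a2 b2 : F) :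
  b1 != 0 -> b2 != 0 ->
  b1 * b2 != 0 /\ (a1 * b2 + b1 * a2) / (b1 * b2) = a1 / b1 + a2 / b2.
Proof.
by move=> n1 n2; rewrite mulf_neq0 // addf_div // [b1 * a2]mulrC.
Qed.

Lemma fractionD x y : is_fraction x -> is_fraction y -> is_fraction (x + y).
Proof.
move=> [a1 [b1 [C1 n1 <-]]] [a2 [b2 [C2 n2 <-]]].
have [N E] := sum_quotient a1 a2 n1 n2.
exists (a1 * b2 + b1 * a2), (b1 * b2).
by split; [exact: coefficients_sum C1 C2 | exact: N | exact: E].
Qed.

Lemma fractionMn x n : is_fraction x -> is_fraction (x *+ n).
Proof.
move=> Fx; elim: n => [|n IH]; first exact: fraction0.
by rewrite mulrS; apply: fractionD.
Qed.

Lemma twist_quotient (F : fieldType) (c a b : F) :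
  b != 0 -> 1 + c * (a / b) != 0 ->
  1 * b + c * a != 0 /\ 1 * a / (1 * b + c * a) = a / b / (1 + c * (a / b)).
Proof.
move=> b0 N.
have E : 1 * b + c * a = (1 + c * (a / b)) * b.
  by rewrite mulrDl -mulrA divfK.
by rewrite E mulf_neq0 // mul1r invfM mulrCA mulrC mulrAC.
Qed.

(** Stacking on the tangle of fraction 1 / z adds z to the inverse of [x]. *)
Lemma fraction_twist x : is_fraction x -> 1 + z * x != 0 ->
  is_fraction (x / (1 + z * x)).
Proof.
move=> [a [b [C n <-]]] /(twist_quotient n) [N E].
by exists (1 * a), (1 * b + z * a); split=> //;
  exact: coefficients_stack (coefficients_inv_z false) C.
Qed.

(** Start from the fraction - c. Stacking with - 1 / c gives - c / (1 + c^2),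
    adding c gives c^3 / (1 + c^2), and stacking with - c gives c^3, the inverse
    of (1 + c^2) / c^3 - 1 / c.  Numerator and denominator have the unsimplified
    form that these operations on coefficients produce. *)
Lemma cube_quotient (F : fieldType) (c : F) : c != 0 ->
  let a := - c * - c + 1 * 1 in
  (- c * 1 * 1 + a * c) * 1 + a * 1 * - c != 0
  /\ (- c * 1 * 1 + a * c) * - c / ((- c * 1 * 1 + a * c) * 1 + a * 1 * - c)
     = c ^+ 3.
Proof.
move=> c0 a.
have -> : (- c * 1 * 1 + a * c) * 1 + a * 1 * - c = - c by rewrite /a; ring.
by rewrite oppr_eq0 c0; split=> //; rewrite mulfK ?oppr_eq0 // /a; ring.
Qed.

Lemma fraction_z3 : is_fraction (z ^+ 3).
Proof.
have C := coefficients_stack (coefficients_sum (coefficients_stack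
  (coefficients_z false) (coefficients_inv_z true)) (coefficients_z true))
  (coefficients_z false).
have [N E] := cube_quotient z_neq0.
move: C N E => /= C N E; eexists; eexists.
by split; [exact: C | exact: N | exact: E].
Qed.

(** * Branch points *)

(** The contribution of a branch point of order [n] to the q-fraction. *)
Definition branch n : ratfun :=
  qhalf * (1 - (- q) ^+ n.-1) / (1 - (- q) ^+ n).

(** For Y = (- t^2)^(n+1) and z = t^-1 - t, one has
    z + r (n+1) = (t^-1 + t Y) / (1 - Y), so that
    1 + z (z + r (n+1)) = (1 - t^4 Y) / (t^2 (1 - Y)), where t^4 Y is
    (- t^2)^(n+3). *)
Lemma branch_step (F : fieldType) (t : F) n : t != 0 ->
  let r m := t * (1 - (- t ^+ 2) ^+ m.-1) / (1 - (- t ^+ 2) ^+ m) in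
  let x := (t^-1 - t) + r n.+1 in
  1 - (- t ^+ 2) ^+ n.+1 != 0 -> 1 - (- t ^+ 2) ^+ n.+3 != 0 ->
  1 + (t^-1 - t) * x != 0 /\ r n.+3 = x / (1 + (t^-1 - t) * x).
Proof.
move=> t0 r x; rewrite /x /r /= {x r} ![(- t ^+ 2) ^+ _.+1]exprS.
move: ((- t ^+ 2) ^+ n) => y N1 N3.
set d := 1 - _ in N1 *; set d' := 1 - _ in N3 *.
have -> : 1 + (t^-1 - t) * (t^-1 - t + t * (1 - y) / d) = d' / (t ^+ 2 * d).
  by rewrite /d' /d; field; rewrite N1.
split; first by rewrite mulf_neq0 // invr_eq0 mulf_neq0 // expf_neq0.
by rewrite /d' /d; field; rewrite N1 t0 N3.
Qed.

Lemma branch_base (F : fieldType) (t : F) :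
  t != 0 -> 1 - (- t ^+ 2) ^+ 2 != 0 ->
  1 / (t^-1 - t) = t * (1 - (- t ^+ 2) ^+ 1) / (1 - (- t ^+ 2) ^+ 2).
Proof.
have -> : 1 - (- t ^+ 2) ^+ 2 = (1 - t ^+ 2) * (1 + t ^+ 2) by ring.
rewrite mulf_eq0 negb_or => t0 /andP[n1 n2].
have -> : t^-1 - t = (1 - t ^+ 2) / t by field.
by field; rewrite t0 n1 n2.
Qed.

Lemma fraction_branch2 : is_fraction (branch 2).
Proof.
exists 1, z; split; [exact: coefficients_inv_z false | exact: z_neq0 |].
exact: branch_base qhalf_neq0 (@one_sub_Nq_exp_neq0 2 isT).
Qed.

Lemma branch_rec n :
  1 + z * (z + branch n.+1) != 0 /\
  branch n.+3 = (z + branch n.+1) / (1 + z * (z + branch n.+1)).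
Proof.
exact: branch_step qhalf_neq0 (@one_sub_Nq_exp_neq0 n.+1 isT)
  (@one_sub_Nq_exp_neq0 n.+3 isT).
Qed.

(** Continued fraction expansion, starting from r_1 = 0 or r_2 = 1 / z according
    to the parity of [n]. *)
Lemma fraction_branch n : (0 < n)%N -> is_fraction (branch n).
Proof.
suff H m : is_fraction (branch m.+1) /\ is_fraction (branch m.+2).
  by case: n => // n _; case: (H n).
elim: m => [|m [F1 F2]].
  have -> : branch 1 = 0 by rewrite /branch expr0 subrr mulr0 mul0r.
  split; first exact: fraction0.
  exact: fraction_branch2.
split=> //; have [N ->] := branch_rec m.
by apply: fraction_twist => //; apply: fractionD => //; apply: fraction_z.
Qed.

(** * The Poincare series *)

(** The left-hand side is t^-3 - t^3 - (g - 2) z, and t^-3 - t^3 = z^3 + 3 z for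
    z = t^-1 - t. *)
Lemma poincare_head (F : fieldType) (t : F) g : t != 0 -> 1 + t ^+ 2 != 0 ->
  (1 + t ^+ 2) ^+ 2 * ((1 + (g%:R - 2) * (- t ^+ 2)
    + (g%:R - 2) * (- t ^+ 2) ^+ 2 + (- t ^+ 2) ^+ 3) / (1 - - t ^+ 2) ^+ 2)
    / t ^+ 3
  = (t^-1 - t) ^+ 3 + (t^-1 - t) *+ 5 + (- (t^-1 - t)) *+ g.
Proof.
move=> t0 n; rewrite opprK -[(- _) *+ g]mulr_natl; move: (g%:R) => c.
by field; rewrite t0 n.
Qed.

Lemma poincare_branch (F : fieldType) (t y y' : F) :
  t != 0 -> 1 + t ^+ 2 != 0 -> 1 - y != 0 ->
  (1 + t ^+ 2) ^+ 2 * ((- t ^+ 2) ^+ 2 * (1 - y')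
    / ((1 - - t ^+ 2) ^+ 2 * (1 - y))) / t ^+ 3
  = t * (1 - y') / (1 - y).
Proof. by move=> t0 n N; rewrite opprK; field; rewrite t0 n N. Qed.

Lemma poincare_decomposition g a : (forall n, n \in a -> (2 <= n)%N) ->
  (1 + q) ^+ 2 * poincare g a (- q) / qhalf ^+ 3
  = z ^+ 3 + z *+ 5 + (- z) *+ g + \sum_(n <- a) branch n.
Proof.
move=> ha; rewrite /poincare mulrDr mulrDl big_distrr big_distrl.
congr (_ + _); first exact: poincare_head qhalf_neq0 one_add_q_neq0.
apply: eq_big_seq => n /ha n2.
exact: poincare_branch qhalf_neq0 one_add_q_neq0
  (one_sub_Nq_exp_neq0 (ltnW n2)).
Qed.

Theorem mainTheorem2 (g : nat) (a : seq nat)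
    (ha : forall n, n \in a -> (2 <= n)%N) :
  exists T : tangle2,
    has_qfraction T ((1 + q) ^+ 2 * poincare g a (- q) / qhalf ^+ 3).
Proof.
suff [x [y [[T E] y0 xy]]] :
    is_fraction ((1 + q) ^+ 2 * poincare g a (- q) / qhalf ^+ 3).
  exists T => Delta DP; rewrite (expands_numerator DP (E _ DP)).
  by rewrite (expands_denominator DP (E _ DP)).
rewrite poincare_decomposition //; apply: fractionD.
  apply: fractionD; last exact: fractionMn fraction_Nz.
  by apply: fractionD; [exact: fraction_z3 | exact: fractionMn fraction_z].
elim: a ha => [|n a IH] ha; first by rewrite big_nil; apply: fraction0.
rewrite big_cons; apply: fractionD.
  by apply: fraction_branch; apply: ltnW; rewrite ha ?mem_head.
by apply: IH => m am; rewrite ha // inE am orbT.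
Qed.
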